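(* Let $q$ be a prime power and $k\ge3$, $h\ge2$ integers, and $1\le u_0<u_1\le\dots\le u_h$ integers. Let $U_0,U_1,\dots,U_h$ be subspaces of $\mathbf F_q^k$ of dimensions $u_0,u_1,\dots,u_h$ with $U_i\cap U_j=U_0$ for all distinct $i,j\in\{1,\dots,h\}$, and assume $q^k-q^{k-1}>q^{u_0}-1+\sum_{i=1}^h(q^{u_i}-q^{u_0})$. Let $U$ be the set of nonzero vectors of $\mathbf F_q^k$ not in $U_1\cup\dots\cup U_h$, let $\widetilde G$ be a matrix whose columns consist of exactly one representative of each class $\{\lambda\mathbf v:\lambda\in\mathbf F_q^*\}$, $\mathbf v\in U$, and let $\mathbf C$ be the linear code with generator matrix $\widetilde G$, with parameters $\big[\frac{(q^k-q^{u_0})-\sum_{i=1}^h(q^{u_i}-q^{u_0})}{q-1},k,d=q^{k-1}-\sum_{i=1}^hq^{u_i-1}\big]_q$. Then $\mathbf C$ is distance optimal in the following cases: 1) $u_1=\dots=u_{s_1}<u_{s_1+1}=\dots=u_{s_1+s_2}<\dots<u_{s_1+\dots+s_{t-1}+1}=\dots=u_{s_1+\dots+s_t}$ with $1\le s_i<q$ ($i=1,\dots,t$), $h=s_1+\dots+s_t$, and $u_1>(h-1)\frac{q^{u_0}-1}{q-1}$; 2) $u_1=\dots=u_h=u$ and $i_h+u>(h-1)\frac{q^{u_0}-1}{q-1}+\sum_{i=1}^{k-u}\lfloor h/q^i\rfloor$.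
   Context: For a positive integer $h$ with $q$-adic expansion $h=h_{m-1}q^{m-1}+\dots+h_0$ ($0\le h_i<q$), $i_h$ denotes the least index $i\ge0$ with $h_i>0$. A linear $[n,k,d]_q$ code is distance optimal if no linear $[n,k,d+1]_q$ code exists. *)

(* Defs.v *)
From HB Require Import structures.
From mathcomp Require Import all_boot all_order all_algebra all_field.
Set Implicit Arguments. Unset Strict Implicit. Unset Printing Implicit Defensive.
Import GRing.Theory.
Local Open Scope ring_scope.

Definition wt (F : fieldType) (n : nat) (x : 'rV[F]_n) : nat :=
  #|[set j : 'I_n | x 0 j != 0]|.
Definition hdist (F : fieldType) (n : nat) (x y : 'rV[F]_n) : nat := wt (x - y).

Definition lin_code_params (F : fieldType) (n : nat) (C : {vspace 'rV[F]_n})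
    (k d : nat) : Prop :=
  [/\ \dim C = k,
      (exists c1, exists c2, [/\ c1 \in C, c2 \in C, c1 != c2 & hdist c1 c2 = d])
    & (forall c1 c2, c1 \in C -> c2 \in C -> c1 != c2 -> (d <= hdist c1 c2)%N)].

Definition distance_optimal (F : fieldType) (n k d : nat) : Prop :=
  ~ exists C : {vspace 'rV[F]_n}, lin_code_params C k d.+1.

Definition code_of (F : fieldType) (k n : nat) (G : 'M[F]_(k, n))
  : {vspace 'rV[F]_n} := (<< [seq row i G | i <- enum 'I_k] >>)%VS.

(* i_h: least index i with nonzero q-adic digit h_i = (h / q^i) mod q
   (for h >= 1, q >= 2 it is < h, so searching in [0, h) suffices). *)
Definition ih (q h : nat) : nat :=
  find (fun i => (h %/ q ^ i) %% q != 0)%N (iota 0 h).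

(* Main.v *)
Require Import Defs.
From HB Require Import structures.
From mathcomp Require Import all_boot all_order all_algebra all_field.
From mathcomp Require Import zify.
Set Implicit Arguments. Unset Strict Implicit. Unset Printing Implicit Defensive.
Import GRing.Theory.
Local Open Scope ring_scope.

(* The weight of [x *m G] counts, up to the factor [q - 1], the vectors outside
   [U_1, ..., U_h] and off the hyperplane orthogonal to [x]. Since the [U_i] form
   a sunflower with core [U_0], this count is exact, and it is minimal when [x]
   annihilates [U_0] but no [U_i]; such an [x] exists because the annihilators of
   the [U_i] are too small to cover that of [U_0]. Optimality is the Griesmer
   bound: a code of minimum distance [d + 1] needs length at least
   [\sum_(i < k) (d %/ q ^ i).+1], and in both cases the rounding errors of
   [d / q ^ i] are small enough for this to exceed [n]. *)

(** * Sums of powers of [q] over blocks of equal exponents, and the digit index *)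

Lemma geometric_sum (q m : nat) :
  (0 < q)%N -> ((q - 1) * (\sum_(i < m) q ^ i) + 1 = q ^ m)%N.
Proof.
move=> q_gt0; have := predn_exp q m; rewrite subn1 => <-.
by rewrite addn1 prednK // expn_gt0 q_gt0.
Qed.

Lemma block_sum (u f : nat -> nat) (a s c : nat) (P : pred nat) :
  (forall j, (a < j <= a + s)%N -> u j = c) ->
  (\sum_(a.+1 <= j < (a + s).+1 | P (u j)) f (u j) = P c * (s * f c))%N.
Proof.
move=> uc; have -> : (s * f c = \sum_(a.+1 <= j < (a + s).+1) f c)%N.
  by rewrite sum_nat_const_nat subSS addKn.
rewrite big_mkcond big_distrr /= !big_nat; apply: eq_bigr => j ja.
by rewrite uc ?ltnS //; case: (P c); rewrite ?mul1n.
Qed.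

Section Blocks.

Variables (q t : nat) (s u : nat -> nat).
Let S (b : nat) := (\sum_(1 <= i < b.+1) s i)%N.
Hypothesis s_bound : forall i, (1 <= i <= t)%N -> (1 <= s i < q)%N.
Hypothesis u_const : forall b, (1 <= b <= t)%N ->
  forall j, (S b.-1 < j <= S b)%N -> u j = u (S b.-1).+1.
Hypothesis u_jump : forall b, (1 <= b < t)%N -> (u (S b) < u (S b).+1)%N.

Lemma block_endS b : S b.+1 = (S b + s b.+1)%N.
Proof. by rewrite /S big_nat_recr. Qed.

Lemma block_end0 : S 0 = 0%N.
Proof. by rewrite /S big_geq. Qed.

Lemma block_end_mono b b' : (b <= b')%N -> (S b <= S b')%N.
Proof. by move=> bb'; rewrite /S [leqRHS](@big_cat_nat _ _ _ b.+1) //= leq_addr. Qed.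

Lemma block_val b j : (b < t)%N -> (S b < j <= S b + s b.+1)%N -> u j = u (S b).+1.
Proof. by move=> bt; rewrite -block_endS => /(@u_const b.+1 bt). Qed.

(** The extra summand carries the induction. A new block of value [c] has at most [q - 1] terms, so
    together with its own extra [q ^ (k - c)] it adds at most [q ^ (k - c).+1], and the jump bounds
    this by the extra summand of the preceding block. *)
Lemma dual_blocks_sum k b : (1 <= b <= t)%N ->
  (forall j, (1 <= j <= S t)%N -> (u j <= k)%N) ->
  (\sum_(1 <= j < (S b).+1) q ^ (k - u j) + q ^ (k - u (S b)) <= q ^ (k - u 1%N).+1)%N.
Proof.
case: b => // b; rewrite andTb => bt uk; elim: b bt => [|b IHb] bt.
  have [s_ge1 s_lt] := andP (@s_bound 1 bt).
  rewrite block_endS block_end0 add0n.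
  have u1c j : (0 < j <= 0 + s 1%N)%N -> u j = u 1%N.
    by have := @block_val 0 j bt; rewrite block_end0; apply.
  rewrite (@block_sum u (fun x => q ^ (k - x))%N 0 _ (u 1%N) xpredT u1c) mul1n.
  by rewrite (u1c (s 1%N)) ?s_ge1 ?add0n ?leqnn // addnC -mulSn expnS leq_mul2r s_lt orbT.
have [s_ge1 s_lt] := andP (@s_bound b.+2 bt).
have St : (S b.+2 <= S t)%N by apply: block_end_mono.
set c := u (S b.+1).+1.
have SbSt : ((S b.+1).+1 <= S t)%N by move: St; rewrite (block_endS b.+1); lia.
have c_le : (c <= k)%N by apply: uk.
have jump : (u (S b.+1) < c)%N by apply: u_jump.
rewrite (block_endS b.+1) (@big_cat_nat _ _ _ (S b.+1).+1) //=; last first.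
  by rewrite ltnS leq_addr.
rewrite (@block_sum u (fun x => q ^ (k - x))%N _ _ c xpredT) => [|j]; last exact: block_val.
rewrite (@block_val b.+1 (S b.+1 + s b.+2)) //; last by lia.
rewrite mul1n -addnA (addnC (_ * _)%N) -mulSn; apply: leq_trans (IHb (ltnW bt)).
rewrite leq_add2l; apply: (@leq_trans (q ^ (k - c).+1)).
  by rewrite expnS leq_mul2r s_lt orbT.
by apply: leq_pexp2l; lia.
Qed.

Hypothesis u_mono : forall i j, (1 <= i <= j)%N -> (j <= S t)%N -> (u i <= u j)%N.
Hypothesis u1_gt0 : (0 < u 1%N)%N.

(** No exponent occurs more than [q - 1] times, so the sum is a base [q] expansion with all its
    digits in positions at most [i]. *)
Lemma low_blocks_sum b i : (0 < q)%N -> (b <= t)%N ->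
  (\sum_(1 <= j < (S b).+1 | u j <= i) q ^ u j < q ^ i.+1)%N.
Proof.
move=> q_gt0; elim: b i => [|b IHb] i bt.
  by rewrite block_end0 big_geq // expn_gt0 q_gt0.
have bt' := ltnW bt; set c := u (S b).+1.
have St : (S b.+1 <= S t)%N by apply: block_end_mono.
have [s_ge1 s_lt] := andP (@s_bound b.+1 bt).
have SbSt : ((S b).+1 <= S t)%N by move: St; rewrite block_endS; lia.
have c_gt0 : (0 < c)%N by apply: leq_trans (@u_mono 1 (S b).+1 _ _).
rewrite block_endS (@big_cat_nat _ _ _ (S b).+1) //=; last by rewrite ltnS leq_addr.
rewrite (@block_sum u (expn q) _ _ c (fun x => x <= i)%N) => [|j]; last exact: block_val.
have [c_le | c_gt] := leqP c i; last first.
  by rewrite mul0n addn0; apply: IHb.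
have uj_lt j : (1 <= j < (S b).+1)%N -> (u j <= c.-1)%N.
  move=> /andP[j1 jS]; rewrite -ltnS prednK //.
  have b_gt0 : (0 < b)%N by case: (b) jS j1 => //; rewrite block_end0; lia.
  apply: leq_ltn_trans (@u_jump b _); last by rewrite b_gt0.
  by apply: u_mono; lia.
(* The earlier blocks lie strictly below [c], so the filter can be lowered to [c.-1]; the induction
   hypothesis then bounds their sum by [q ^ c]. *)
have low : (\sum_(1 <= j < (S b).+1 | u j <= i) q ^ u j
            = \sum_(1 <= j < (S b).+1 | u j <= c.-1) q ^ u j)%N.
  rewrite [LHS]big_mkcond [RHS]big_mkcond !big_nat; apply: eq_bigr => j /uj_lt uj.
  by rewrite uj (leq_trans uj) // (leq_trans (leq_pred _)).
have := IHb c.-1 bt'; rewrite -low prednK // mul1n => low_lt.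
apply: (@leq_trans (q * q ^ c)); last by rewrite -expnS leq_pexp2l; lia.
have : (s b.+1 * q ^ c <= q.-1 * q ^ c)%N by rewrite leq_mul2r; lia.
have -> : (q * q ^ c = q.-1 * q ^ c + q ^ c)%N by rewrite -{1}(prednK q_gt0) mulSn addnC.
lia.
Qed.

End Blocks.

Lemma expn_ih_dvdn (q h : nat) : (q ^ ih q h %| h)%N.
Proof.
suff H m : (m <= ih q h)%N -> (q ^ m %| h)%N by apply: H.
elim: m => [|m IHm] m_lt; first exact: dvd1n.
have m_lt_h : (m < h)%N.
  by apply: leq_trans m_lt _; rewrite -[X in (_ <= X)%N](size_iota 0) find_size.
have := before_find 0%N m_lt; rewrite nth_iota // add0n => /negbFE qdvd.
rewrite expnSr -(divnK (IHm (ltnW m_lt))) mulnC dvdn_mul //.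
Qed.

Lemma dvdn_le_ih (q h m : nat) : (m <= ih q h)%N -> (q ^ m %| h)%N.
Proof. by move=> m_le; apply: dvdn_trans (dvdn_exp2l _ m_le) (expn_ih_dvdn q h). Qed.

(* Makes the annihilators too small to cover: there are [h] of them, of index [q ^ w] in that of [U_0]. *)
Lemma case2_few_subspaces (q h u0 w m : nat) :
  (1 < q)%N -> (1 < h)%N -> (0 < u0)%N -> (0 < w)%N -> (h < q ^ m)%N ->
  ((h - 1) * (\sum_(i < u0) q ^ i) + \sum_(1 <= i < m.+1) h %/ q ^ i
     < ih q h + (u0 + w))%N ->
  (h <= q ^ w)%N.
Proof.
move=> q_gt1 h_gt1 u0_gt0 w_gt0 h_lt hyp; rewrite leqNgt; apply/negP => h_gt.
have q_gt0 : (0 < q)%N by lia.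
have w_lt : (w < m)%N by rewrite -(ltn_exp2l _ _ q_gt1); lia.
(* If [h > q ^ w], the first [w] quotients are positive and cancel [w] in the hypothesis. What
   remains is contradicted by [ih q h <= h - 2] and [u0 <= \sum_(i < u0) q ^ i]. *)
have sum_w : (w <= \sum_(1 <= i < m.+1) h %/ q ^ i)%N.
  rewrite (@big_cat_nat _ _ _ w.+1) //= ?ltnS ?(ltnW w_lt) //.
  apply: leq_trans (leq_addr _ _).
  have {1}-> : w = (\sum_(1 <= i < w.+1) 1)%N by rewrite sum_nat_const_nat; lia.
  rewrite !big_nat; apply: leq_sum => i /andP[_ iw].
  rewrite divn_gt0 ?expn_gt0 ?q_gt0 //; apply: leq_trans (ltnW h_gt).
  by rewrite leq_pexp2l.
have theta : (u0 <= \sum_(i < u0) q ^ i)%N.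
  have {1}<- : (\sum_(i < u0) 1 = u0)%N by rewrite sum1_card card_ord.
  apply: leq_sum => i _.
  by rewrite expn_gt0 q_gt0.
have ih_lt : (q ^ ih q h <= h)%N by apply: dvdn_leq (expn_ih_dvdn _ _); lia.
have h_gt2 : (2 < h)%N by have := leq_pexp2l q_gt0 w_gt0; rewrite expn1; lia.
have ih_h : (ih q h + 2 <= h)%N.
  case: (ih q h) ih_lt => [|a]; first by lia.
  by rewrite expnS; have := ltn_expl a q_gt1; nia.
have : ((h - 1) * u0 <= (h - 1) * (\sum_(i < u0) q ^ i))%N by rewrite leq_mul2l theta orbT.
have : (h - 2 + u0 <= (h - 1) * u0)%N by nia.
by move: hyp sum_w; lia.
Qed.

(** * The Griesmer bound by residual codes *)

Definition wt_on (F : fieldType) (n : nat) (J : {set 'I_n}) (c : 'rV[F]_n) : nat :=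
  #|[set j in J | c 0 j != 0]|.

(** The coordinates that survive in the residual code with respect to [c]. *)
Definition zeros_in (F : fieldType) (n : nat) (J : {set 'I_n}) (c : 'rV[F]_n) : {set 'I_n} :=
  [set j in J | c 0 j == 0].

Lemma wt_onE (F : fieldType) (n : nat) (J : {set 'I_n}) (c : 'rV[F]_n) :
  (wt_on J c = \sum_(j in J) (c 0%R j != 0%R))%N.
Proof.
by rewrite /wt_on -sum1_card -[RHS]big_mkcondr; apply: eq_bigl => j; rewrite !inE.
Qed.

Lemma wt_on_zeros (F : fieldType) (n : nat) (J : {set 'I_n}) (c : 'rV[F]_n) :
  (wt_on J c + #|zeros_in J c| = #|J|)%N.
Proof.
rewrite -(cardsID [set j | c 0 j != 0] J); congr (_ + _)%N.
  by apply: eq_card => j; rewrite !inE.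
by apply: eq_card => j; rewrite !inE negbK andbC.
Qed.

(* Averaging over the translates [c' - a *: c]: each coordinate in the support
   of [c] vanishes for exactly one [a]. *)
Lemma residual_weight (F : finFieldType) (n : nat) (J : {set 'I_n}) (c c' : 'rV[F]_n) :
  (forall a : F, wt_on J c <= wt_on J (c' - a *: c)%R)%N ->
  (wt_on J c <= #|F| * wt_on (zeros_in J c) c')%N.
Proof.
move=> w_min.
have sumE : (\sum_(a : F) wt_on J (c' - a *: c)%R
    = #|F|.-1 * wt_on J c + #|F| * wt_on (zeros_in J c) c')%N.
  under eq_bigr => a _ do rewrite wt_onE.
  rewrite exchange_big /= !wt_onE.
  under [X in (_ = _ + _ * X)%N]eq_bigl => j do rewrite inE.
  rewrite big_mkcondr /= !big_distrr -big_split /=.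
  apply: eq_bigr => j _; case: eqP => [c0 | /eqP c_neq0] /=.
    rewrite muln0 add0n.
    under eq_bigr => a _ do rewrite !mxE c0 mulr0 subr0.
    by rewrite sum_nat_const.
  rewrite muln1 muln0 addn0 -(cardC1 (c' 0 j / c 0 j)) -sum1_card [RHS]big_mkcond.
  apply: eq_bigr => a _; rewrite !mxE subr_eq0 inE eq_sym.
  by rewrite -(can2_eq (mulfK c_neq0) (mulfVK c_neq0)); case: eqP.
have : (\sum_(a : F) wt_on J c <= \sum_(a : F) wt_on J (c' - a *: c)%R)%N.
  by apply: leq_sum => a _; apply: w_min.
rewrite sumE sum_nat_const.
have : (0 < #|F|)%N by apply/card_gt0P; exists 0.
by case: #|F| => // m _; rewrite mulSn /= addnC leq_add2l.
Qed.

(* Stated relative to a set [J] of coordinates, so that passing to the residual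
   code only shrinks [J]. *)
Lemma griesmer_bound (F : finFieldType) (n d : nat) (C : {vspace 'rV[F]_n}) (J : {set 'I_n}) :
  (forall c, c \in C -> c != 0%R -> d < wt_on J c)%N ->
  (\sum_(i < \dim C) (d %/ #|F| ^ i).+1 <= #|J|)%N.
Proof.
have [m dimC] : exists m, \dim C = m by exists (\dim C).
elim: m d C J dimC => [|m IHm] d C J dimC C_min; first by rewrite dimC big_ord0.
have q_gt0 : (0 < #|F|)%N by apply/card_gt0P; exists 0.
have C_neq0 : (vpick C \in C) && (vpick C != 0).
  by rewrite memv_pick vpick0 -dimv_eq0 dimC.
case: (@arg_minnP _ _ (fun c => (c \in C) && (c != 0)) (wt_on J) C_neq0) => c.
case/andP => cC c0 c_min.
(* The residual code is a complement of the minimum weight word [c], read on [J'] only. As it meets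
   the line of [c] trivially, no translate [c' - a *: c] of a nonzero [c'] vanishes, and each weighs
   at least as much as [c]. *)
pose C' := (C :\: <[c]>)%VS; pose J' := zeros_in J c.
have capC' : (<[c]> :&: C' = 0)%VS by rewrite /C' capvC capv_diff.
have dimC' : \dim C' = m.
  have := dimv_cap_compl C <[c]>; rewrite dimC.
  have -> : (C :&: <[c]> = <[c]>)%VS by apply/capv_idPr; rewrite -memvE.
  by rewrite dim_vline c0 => [[]].
have C'_min c' : c' \in C' -> c' != 0 -> (d %/ #|F| < wt_on J' c')%N.
  move=> c'C' c'0; rewrite ltn_divLR // mulnC.
  apply: leq_trans (residual_weight _); first exact: C_min.
  have c'C := subvP (diffvSl C <[c]>) _ c'C'.
  move=> a; apply: c_min; rewrite rpredB ?rpredZ //=.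
  rewrite subr_eq0; apply: contraNneq c'0 => c'E.
  by rewrite -memv0 -capC' memv_cap c'C' {1}c'E memvZ ?memv_line.
have := IHm _ C' J' dimC' C'_min; rewrite dimC' dimC big_ord_recl expn0 divn1 => tail.
rewrite -(wt_on_zeros J c); apply: leq_add; first exact: C_min.
by under eq_bigr => i _ do rewrite /= /bump add1n expnS divnMA.
Qed.

(** * Hyperplanes, annihilators and their cardinalities *)

Section Hyperplanes.

Variables (F : finFieldType) (k : nat).
Implicit Types (x v : 'rV[F]_k) (V : {vspace 'rV[F]_k}).
Let q := #|F|.

(** At [x = 0] this is the whole space, so [x] can range over all vectors. *)
Definition hyperplane x : {vspace 'rV[F]_k} := lker (linfun (mulmxr x^T : 'rV[F]_k -> 'rV[F]_1)).

Lemma mem_hyperplane x v : (v \in hyperplane x) = (v *m x^T == 0).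
Proof. by rewrite memv_ker lfunE. Qed.

Lemma mem_hyperplaneC x v : (v \in hyperplane x) = (x \in hyperplane v).
Proof. by rewrite !mem_hyperplane -(inj_eq trmx_inj) trmx_mul trmxK trmx0. Qed.

Lemma hyperplane_proper x : (fullv <= hyperplane x)%VS = (x == 0).
Proof.
apply/subvP/eqP => [full | -> v _]; last by rewrite mem_hyperplane trmx0 mulmx0.
apply/rowP => i; have := full (delta_mx 0 i) (memvf _).
by rewrite mem_hyperplane -rowE => /eqP/rowP/(_ 0); rewrite !mxE.
Qed.

(** A linear form that is nonzero on [V] has an image of dimension one, hence a kernel of
    codimension one in [V]. *)
Lemma card_off_hyperplane x V :
  #|[set v in V | v \notin hyperplane x]|
  = (~~ (V <= hyperplane x)%VS * (q ^ \dim V - q ^ (\dim V).-1))%N.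
Proof.
have cardV : (#|(V :&: hyperplane x)%VS| + #|[set v in V | v \notin hyperplane x]| = q ^ \dim V)%N.
  rewrite -card_vspace -[RHS](cardID [in hyperplane x]); congr (_ + _)%N.
    by apply: eq_card => v; rewrite !inE memv_cap.
  by apply: eq_card => v; rewrite !inE andbC.
move: cardV; rewrite card_vspace; have [/capv_idPl -> | V_out] /= := boolP (_ <= _)%VS.
  by rewrite mul0n -[X in _ = X -> _]addn0 => /addnI.
have := limg_ker_dim (linfun (mulmxr x^T : 'rV[F]_k -> 'rV[F]_1)) V.
have -> : \dim (linfun (mulmxr x^T : 'rV[F]_k -> 'rV[F]_1) @: V) = 1%N.
  apply/eqP; rewrite eqn_leq lt0n dimv_eq0 -lkerE V_out andbT.
  by apply: leq_trans (dimvS (subvf _)) _; rewrite dimvf.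
by rewrite -/(hyperplane x) addn1 => <- /=; rewrite mul1n => <-; rewrite addKn.
Qed.

(** Double counting of the pairs [(x, v)] with [v] in [V] off [hyperplane x]: the count by [x]
    involves [N], the count by [v] is explicit. *)
Lemma card_annihilator V : (0 < \dim V)%N ->
  #|[set x | (V <= hyperplane x)%VS]| = (q ^ (k - \dim V))%N.
Proof.
move=> V_gt0; set N := #|_|.
have dimVk : (\dim V <= k)%N by have := dimvS (subvf V); rewrite dimvf /dim /= mul1n.
have q_gt1 : (1 < q)%N by apply: finRing_gt1.
have dbl : (\sum_x #|[set v in V | v \notin hyperplane x]|
    = \sum_(v in V) #|[set x in {:'rV[F]_k}%VS | x \notin hyperplane v]|)%N.
  under eq_bigr => x _ do rewrite -sum1_card.
  under [RHS]eq_bigr => v _ do rewrite -sum1_card.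
  rewrite [RHS](exchange_big_dep xpredT) //=; apply: eq_bigr => x _.
  by apply: eq_bigl => v; rewrite !inE memvf mem_hyperplaneC.
have lhs : (\sum_x #|[set v in V | v \notin hyperplane x]|
    = (q ^ k - N) * (q ^ \dim V - q ^ (\dim V).-1))%N.
  under eq_bigr => x _ do rewrite card_off_hyperplane.
  rewrite -big_distrl; congr (_ * _)%N => /=.
  have -> : (q ^ k = #|{: 'rV[F]_k}|)%N by rewrite card_mx mul1n.
  rewrite -[X in (X - _)%N](cardsC [set x | (V <= hyperplane x)%VS]) addKn -sum1_card.
  by rewrite [RHS]big_mkcond; apply: eq_bigr => x _; rewrite !inE; case: (_ <= _)%VS.
have rhs : (\sum_(v in V) #|[set x in {:'rV[F]_k}%VS | x \notin hyperplane v]|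
    = (q ^ \dim V).-1 * (q ^ k - q ^ k.-1))%N.
  under eq_bigr => x _ do rewrite card_off_hyperplane hyperplane_proper.
  rewrite -big_distrl dimvf /dim /= mul1n; congr (_ * _)%N.
  by rewrite (bigD1 0) ?mem0v //= eqxx add0n -card_vspace (cardD1 0) mem0v /=
    -sum1_card; apply: eq_big => v; [rewrite !inE andbC | case/andP => _ ->].
have Nk : (N <= q ^ k)%N.
  by have := max_card [set x | (V <= hyperplane x)%VS]; rewrite card_mx mul1n.
move: dbl; rewrite lhs rhs.
case: (\dim V) V_gt0 dimVk => // m _; case: (k) Nk => // k' Nk mk.
rewrite !expnS /= subSS.
have pm : (0 < q ^ m)%N by rewrite expn_gt0; lia.
have -> : (q ^ k' = q ^ (k' - m) * q ^ m)%N by rewrite -expnD subnK.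
move: Nk; rewrite expnS; have -> : (q ^ k' = q ^ (k' - m) * q ^ m)%N by rewrite -expnD subnK.
(* With [A = q ^ m] and [B = q ^ (k' - m)], cancelling [(q - 1) * A] leaves
   [q * A * B - N = (q * A - 1) * B], that is [N = B]. *)
move: (q ^ m)%N (q ^ (k' - m))%N pm => A B A0 Nk eqN.
have c_gt0 : (0 < (q - 1) * A)%N by rewrite muln_gt0 A0 subn_gt0 q_gt1.
move: eqN; have -> : (q * A - A = (q - 1) * A)%N by rewrite mulnBl mul1n.
have -> : (q * (B * A) - B * A = B * ((q - 1) * A))%N by rewrite mulnBl mul1n mulnBr; lia.
rewrite (mulnA (q * A).-1) => /eqP; rewrite eqn_pmul2r // => /eqP.
have : (B <= q * A * B)%N by rewrite leq_pmull // muln_gt0 A0 ltnW.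
rewrite -subn1 mulnBl mul1n (mulnC B A) -mulnA => Ble eqN.
by move: Nk; rewrite (mulnC B A); move: Ble eqN; move: (q * (A * B))%N => X; lia.
Qed.

(** Otherwise the annihilators of the [U i] cover that of [U0]. They all share the zero vector, so
    their sizes then add up to strictly more. *)
Lemma exists_hyperplane (h : nat) (U0 : {vspace 'rV[F]_k}) (U : 'I_h -> {vspace 'rV[F]_k}) :
  (1 < h)%N -> (0 < \dim U0)%N -> (forall i, 0 < \dim (U i))%N ->
  (\sum_(i < h) q ^ (k - \dim (U i)) <= q ^ (k - \dim U0))%N ->
  exists x, (U0 <= hyperplane x)%VS /\ forall i, ~~ (U i <= hyperplane x)%VS.
Proof.
move=> h_gt1 U0_gt0 U_gt0 few.
case: (pickP (fun x => (U0 <= hyperplane x)%VS && [forall i, ~~ (U i <= hyperplane x)%VS])).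
  by move=> x /andP[U0x /forallP Ux]; exists x.
move=> cover; suff : (q ^ (k - \dim U0) < \sum_(i < h) q ^ (k - \dim (U i)))%N by lia.
have cardE (V : {vspace 'rV[F]_k}) : (0 < \dim V)%N ->
    (q ^ (k - \dim V) = \sum_x (V <= hyperplane x)%VS)%N.
  move=> V0; rewrite -card_annihilator // -sum1_card [LHS]big_mkcond.
  by apply: eq_bigr => x _; rewrite inE; case: (_ <= _)%VS.
rewrite cardE //; under [ltnRHS]eq_bigr => i _ do rewrite cardE //.
(* Strictness comes from [x = 0], counted once on the left and [h > 1] times on the right. *)
rewrite exchange_big (bigD1 0) //= [ltnRHS](bigD1 0) //= -addSn; apply: leq_add.
  have zero V : (V <= hyperplane 0)%VS.
    by apply: subv_trans (subvf V) _; rewrite hyperplane_proper.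
  by rewrite zero; under eq_bigr => i _ do rewrite zero; rewrite sum1_card card_ord.
apply: leq_sum => x _; have := cover x; case: (U0 <= _)%VS => //= /negbT.
by rewrite negb_forall => /existsP[i /negPn Ui]; rewrite (bigD1 i) //= Ui.
Qed.

End Hyperplanes.

(** * Counting in sunflowers and in cones over representatives *)

(** A point of the core lies in all [h] petals, any other point in at most one. Having two petals
    puts the core inside each of them. *)
Lemma card_sunflower (T : finType) (h : nat) (A : 'I_h -> {set T}) (B : {set T}) :
  (1 < h)%N -> (forall i j, i != j -> A i :&: A j = B) ->
  (#|\bigcup_i A i| + (h - 1) * #|B| = \sum_(i < h) #|A i|)%N.
Proof.
move=> h_gt1 AB.
have BA i : B \subset A i.
  have [j ij] : exists j, i != j.
    have i0 : (0 < h)%N by lia.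
    case: (eqVneq i (Ordinal i0)) => [-> | ]; last by exists (Ordinal i0).
    by exists (Ordinal h_gt1).
  by rewrite -(AB _ _ ij) subsetIl.
have cardE (D : {set T}) : #|D| = (\sum_x (x \in D))%N.
  by rewrite -sum1_card big_mkcond; apply: eq_bigr => x _; case: (_ \in _).
under [RHS]eq_bigr => i _ do rewrite cardE.
rewrite exchange_big !cardE big_distrr -big_split; apply: eq_bigr => x _ /=.
have [xB | xB] := boolP (x \in B).
  under [RHS]eq_bigr => i _ do rewrite (subsetP (BA i)) //.
  have i0 : (0 < h)%N by lia.
  rewrite sum1_card card_ord; have -> : x \in \bigcup_i A i.
    by apply/bigcupP; exists (Ordinal i0); rewrite ?(subsetP (BA _)).
  lia.
rewrite muln0 addn0; have [/bigcupP[i _ xi] | xA] := boolP (x \in \bigcup_i A i).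
  rewrite (bigD1 i) //= xi big1 // => j ji; apply/eqP; rewrite eqb0.
  by apply: contra xB => xj; rewrite -(AB _ _ ji) inE xi xj.
rewrite big1 // => i _; apply/eqP; rewrite eqb0; apply: contra xA => xi.
by apply/bigcupP; exists i.
Qed.

(** [W] is the disjoint union of the punctured lines through the [g j], and [P] contains or misses
    each of them entirely. *)
Lemma card_cone (F : finFieldType) (k n : nat) (g : 'I_n -> 'rV[F]_k) (W P : {set 'rV[F]_k}) :
  (forall j, g j != 0) ->
  (forall j j', j != j' -> forall a : F, g j != a *: g j') ->
  (forall v, (v \in W) = [exists j, exists a : F, (a != 0) && (v == a *: g j)]) ->
  (forall (a : F) v, a != 0 -> (a *: v \in P) = (v \in P)) ->
  ((#|F| - 1) * #|[set j | g j \in P]| = #|W :&: P|)%N.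
Proof.
move=> g0 gP WE PZ.
have -> : W :&: P = [set p.2 *: g p.1 | p in setX [set j | g j \in P] [set~ 0]].
  apply/setP => v; rewrite inE WE; apply/andP/imsetP => [[] | [[j a]]].
    case/existsP => j /existsP[a /andP[a0 /eqP ->]]; rewrite PZ // => gj.
    by exists (j, a) => //; rewrite !inE gj.
  rewrite !inE /= => /andP[gj a0] ->; rewrite PZ //; split=> //.
  by apply/existsP; exists j; apply/existsP; exists a; rewrite a0 eqxx.
rewrite card_in_imset => [|[j a] [j' a']]; first by rewrite cardsX cardsC1 subn1 mulnC.
rewrite !inE /= => /andP[_ a0] /andP[_ a'0] eq_g.
have jj' : j = j'.
  apply/eqP; apply/negPn/negP => /gP/(_ (a^-1 * a')).
  by rewrite -scalerA -eq_g scalerA mulVf // scale1r eqxx.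
move: eq_g; rewrite jj' => /eqP.
by rewrite -subr_eq0 -scalerBl scaler_eq0 (negbTE (g0 j')) orbF subr_eq0 => /eqP ->.
Qed.

(** * Parameters of a code given by a generator matrix *)

Lemma code_ofE (F : fieldType) (k n : nat) (G : 'M[F]_(k, n)) :
  code_of G = limg (linfun (mulmxr G : 'rV[F]_k -> 'rV[F]_n)).
Proof.
apply: subv_anti; apply/andP; split.
  apply/span_subvP => _ /mapP[i _ ->]; apply/memv_imgP.
  by exists (delta_mx 0 i); rewrite ?memvf // lfunE /= rowE.
apply/subvP => _ /memv_imgP[x _ ->]; rewrite lfunE /= mulmx_sum_row.
apply: memv_suml => i _; rewrite memvZ // memv_span //.
by apply/mapP; exists i; rewrite ?mem_enum.
Qed.

Lemma code_ofP (F : fieldType) (k n : nat) (G : 'M[F]_(k, n)) (c : 'rV[F]_n) :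
  reflect (exists x, c = x *m G) (c \in code_of G).
Proof.
rewrite code_ofE; apply: (iffP memv_imgP) => [[x _ ->] | [x ->]]; exists x => //.
- by rewrite lfunE.
- exact: memvf.
- by rewrite lfunE.
Qed.

Lemma dim_code_of (F : fieldType) (k n : nat) (G : 'M[F]_(k, n)) :
  (forall x : 'rV_k, x *m G = 0 -> x = 0) -> \dim (code_of G) = k.
Proof.
move=> G_inj; rewrite code_ofE limg_dim_eq; first by rewrite dimvf /dim /= mul1n.
apply/eqP; rewrite -subv0; apply/subvP => x; rewrite memv_cap memv_ker lfunE /=.
by case/andP => _ /eqP/G_inj ->; rewrite mem0v.
Qed.

(** A positive lower bound on the weights makes [x *m G] injective in [x], which gives the
    dimension; distances reduce to weights by linearity. *)
Lemma linear_code_params (F : fieldType) (k n d : nat) (G : 'M[F]_(k, n)) :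
  (0 < d)%N ->
  (forall x : 'rV_k, x != 0 -> (d <= wt (x *m G))%N) ->
  (exists x : 'rV_k, wt (x *m G) = d) ->
  lin_code_params (code_of G) k d.
Proof.
move=> d_gt0 d_min [x0 x0E].
have wt0 : wt (0 : 'rV[F]_n) = 0%N.
  by apply/eqP; rewrite cards_eq0; apply/eqP/setP => j; rewrite !inE mxE eqxx.
split.
- apply: dim_code_of => x xG; apply/eqP; apply/negPn/negP => /d_min.
  by rewrite xG wt0 leqNgt d_gt0.
- exists (x0 *m G), 0; split; rewrite ?mem0v //.
  + by apply/code_ofP; exists x0.
  + by apply: contraTneq d_gt0 => x0G; rewrite -x0E x0G wt0.
  + by rewrite /hdist subr0.
move=> _ _ /code_ofP[x ->] /code_ofP[y ->] xy.
rewrite /hdist -mulmxBl; apply: d_min.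
by rewrite subr_eq0; apply: contraNneq xy => ->.
Qed.

(** * Length and weights of the arrangement code *)

(** The traces of the petals on [P] again form a sunflower, with core the trace of [B]. *)
Lemma card_sunflowerC (T : finType) (h : nat) (A : 'I_h -> {set T}) (B P : {set T}) :
  (1 < h)%N -> (forall i j, i != j -> A i :&: A j = B) ->
  (#|~: (\bigcup_i A i) :&: P| + \sum_(i < h) #|A i :&: P| = #|P| + (h - 1) * #|B :&: P|)%N.
Proof.
move=> h_gt1 AB; have ABP i j : i != j -> (A i :&: P) :&: (A j :&: P) = B :&: P.
  by move=> /AB <-; rewrite setIACA setIid.
rewrite -(card_sunflower h_gt1 ABP) addnA; congr (_ + _)%N.
rewrite -(cardsID (\bigcup_i A i) P) addnC setDE [P :&: ~: _]setIC; congr (_ + _)%N.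
by rewrite [P :&: _]setIC big_distrl.
Qed.

Lemma wt_mulmx (F : finFieldType) (k n : nat) (G : 'M[F]_(k, n)) (x : 'rV[F]_k) :
  wt (x *m G) = #|[set j | (col j G)^T \in [set v | v \notin hyperplane x]]|.
Proof.
apply: eq_card => j; rewrite !inE mem_hyperplane.
have xGj : (x *m G) 0 j = ((col j G)^T *m x^T) 0 0.
  by rewrite !mxE; apply: eq_bigr => i _; rewrite !mxE mulrC.
congr negb; apply/eqP/eqP => [xG0 | H]; last by rewrite xGj H mxE.
by apply/matrixP => a b; rewrite !ord1 -xGj xG0 mxE.
Qed.

Section ArrangementCode.

Variables (F : finFieldType) (k h n : nat) (U : nat -> {vspace 'rV[F]_k}) (G : 'M[F]_(k, n)).
Let q := #|F|.
Let u i := \dim (U i).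
Hypothesis h_gt1 : (1 < h)%N.
Hypothesis u0_gt0 : (0 < u 0)%N.
Hypothesis u_gt : forall i : 'I_h, (u 0 < u i.+1)%N.
Hypothesis UI : forall i j : 'I_h, i != j -> (U i.+1 :&: U j.+1)%VS = U 0%N.
Hypothesis G_out : forall j (i : 'I_h), (col j G)^T \notin U i.+1.
Hypothesis G_indep : forall j j' : 'I_n, j != j' ->
  forall a : F, (col j G)^T != a *: (col j' G)^T.
Hypothesis G_all : forall v : 'rV[F]_k, (forall i : 'I_h, v \notin U i.+1) ->
  exists j : 'I_n, exists a : F, v = a *: (col j G)^T.

Let q_gt1 : (1 < q)%N. Proof. exact: finRing_gt1. Qed.

Lemma dim_arrangement (V : {vspace 'rV[F]_k}) : (\dim V <= k)%N.
Proof. by have := dimvS (subvf V); rewrite dimvf /dim /= mul1n. Qed.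

(** The common source of two counts: [P] is the whole space for the length, and the complement of a
    hyperplane for the weights. *)
Lemma card_columns (P : {set 'rV[F]_k}) :
  (forall (a : F) v, a != 0 -> (a *: v \in P) = (v \in P)) ->
  ((q - 1) * #|[set j | (col j G)^T \in P]|
     + \sum_(i < h) #|[set v in U i.+1] :&: P|
   = #|P| + (h - 1) * #|[set v in U 0%N] :&: P|)%N.
Proof.
move=> PZ; pose i0 : 'I_h := Ordinal (ltnW h_gt1).
have AB (i j : 'I_h) : i != j -> [set v in U i.+1] :&: [set v in U j.+1] = [set v in U 0%N].
  by move=> /UI <-; apply/setP => v; rewrite !inE memv_cap.
rewrite -(card_sunflowerC P h_gt1 AB); congr (_ + _)%N; apply: card_cone => // [j|v].
  by apply: contraNneq (G_out j i0) => ->; rewrite mem0v.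
rewrite inE; apply/idP/existsP => [v_out | [j /existsP[a /andP[a0 /eqP ->]]]].
  have {}v_out (i : 'I_h) : v \notin U i.+1.
    by apply: contra v_out => vi; apply/bigcupP; exists i; rewrite ?inE.
  have [j [a v_eq]] := G_all v_out; exists j; apply/existsP; exists a.
  rewrite v_eq eqxx andbT; apply: contraNneq (v_out i0) => a0.
  by rewrite v_eq a0 scale0r mem0v.
apply/bigcupP => [[i _]].
by rewrite inE rpredZeq (negbTE a0) /= (negbTE (G_out j i)).
Qed.

Lemma card_subspaceI_setT (V : {vspace 'rV[F]_k}) :
  #|[set v in V] :&: setT| = (q ^ \dim V)%N.
Proof. by rewrite setIT -card_vspace; apply: eq_card => v; rewrite inE. Qed.

Lemma arrangement_length :
  (n * (q - 1) + \sum_(i < h) q ^ u i.+1 = q ^ k + (h - 1) * q ^ u 0)%N.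
Proof.
have := @card_columns setT; under eq_bigr => i _ do rewrite card_subspaceI_setT.
rewrite card_subspaceI_setT cardsT card_mx mul1n => <- => [|a v _]; last by rewrite !inE.
rewrite mulnC; congr (_ * _ + _)%N; rewrite -[LHS](card_ord n) -cardsT.
by apply: eq_card => j; rewrite !inE.
Qed.

Lemma arrangement_weight (x : 'rV[F]_k) :
  ((q - 1) * wt (x *m G)
     + \sum_(i < h) ~~ (U i.+1 <= hyperplane x)%VS * (q ^ u i.+1 - q ^ (u i.+1).-1)
   = (x != 0%R) * (q ^ k - q ^ k.-1)
     + (h - 1) * (~~ (U 0%N <= hyperplane x)%VS * (q ^ u 0 - q ^ (u 0).-1)))%N.
Proof.
have off (V : {vspace 'rV[F]_k}) : #|[set v in V] :&: [set v | v \notin hyperplane x]|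
    = (~~ (V <= hyperplane x)%VS * (q ^ \dim V - q ^ (\dim V).-1))%N.
  by rewrite -card_off_hyperplane; apply: eq_card => v; rewrite !inE.
have := card_columns (P := [set v | v \notin hyperplane x]).
rewrite off -wt_mulmx; under eq_bigr => i _ do rewrite off.
have -> : #|[set v | v \notin hyperplane x]| = ((x != 0%R) * (q ^ k - q ^ k.-1))%N.
  have := off fullv; rewrite hyperplane_proper dimvf /dim /= mul1n => <-.
  by apply: eq_card => v; rewrite !inE memvf.
apply=> a v a0; rewrite !inE rpredZeq (negbTE a0) //.
Qed.

Lemma sum_expn_pred :
  ((q - 1) * (\sum_(i < h) q ^ (u i.+1).-1) = \sum_(i < h) (q ^ u i.+1 - q ^ (u i.+1).-1))%N.
Proof.
rewrite big_distrr /=; apply: eq_bigr => i _; have := u_gt i.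
by case: (u i.+1) => // m _; rewrite expnS mulnBl mul1n.
Qed.

Hypothesis small : (q ^ k - q ^ k.-1
  > q ^ u 0 - 1 + \sum_(i < h) (q ^ u i.+1 - q ^ u 0))%N.

Let D := (\sum_(i < h) q ^ (u i.+1).-1)%N.

Lemma dim_ambient_gt0 : (0 < k)%N.
Proof. exact: leq_trans u0_gt0 (dim_arrangement _). Qed.

Lemma expn_ambient_pred : (q ^ k - q ^ k.-1 = (q - 1) * q ^ k.-1)%N.
Proof. by case: (k) dim_ambient_gt0 => // k' _; rewrite expnS mulnBl mul1n. Qed.

(** After multiplication by [q - 1] this follows from [small], since [u 0 <= (u i.+1).-1]. It makes
    the minimum distance positive. *)
Lemma arrangement_defect_lt : (D < q ^ k.-1)%N.
Proof.
have q1 : (0 < q - 1)%N by rewrite subn_gt0.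
rewrite -(ltn_pmul2l q1) sum_expn_pred -expn_ambient_pred.
apply: leq_trans small; rewrite ltnS; apply: leq_trans (leq_addl _ _).
apply: leq_sum => i _; apply: leq_sub2l; apply: leq_pexp2l; first exact: ltnW.
by rewrite -ltnS (ltn_predK (u_gt i)) u_gt.
Qed.

(** In the weight formula the term of [U 0] only adds, and each [U i.+1] subtracts at most its full
    share. *)
Lemma arrangement_weight_ge (x : 'rV[F]_k) : x != 0 -> (q ^ k.-1 - D <= wt (x *m G))%N.
Proof.
move=> x0; have q1 : (0 < q - 1)%N by rewrite subn_gt0.
rewrite leq_subLR -(leq_pmul2l q1) mulnDr sum_expn_pred -expn_ambient_pred.
have := arrangement_weight x; rewrite x0 mul1n => wtE.
suff : (\sum_(i < h) ~~ (U i.+1 <= hyperplane x)%VS * (q ^ u i.+1 - q ^ (u i.+1).-1)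
    <= \sum_(i < h) (q ^ u i.+1 - q ^ (u i.+1).-1))%N.
  by move=> XY; rewrite addnC; apply: leq_trans (leq_add (leqnn _) XY); rewrite wtE leq_addr.
by apply: leq_sum => i _; case: (~~ _); rewrite ?mul1n.
Qed.

Lemma arrangement_weight_eq :
  (\sum_(i < h) q ^ (k - u i.+1) <= q ^ (k - u 0))%N ->
  exists x : 'rV[F]_k, wt (x *m G) = (q ^ k.-1 - D)%N.
Proof.
move=> few; have q1 : (0 < q - 1)%N by rewrite subn_gt0.
have U_gt0 (i : 'I_h) : (0 < \dim (U i.+1))%N by apply: leq_trans (u_gt i).
have [x [U0x Ux]] := exists_hyperplane h_gt1 u0_gt0 U_gt0 few; exists x.
have x0 : x != 0.
  pose i0 : 'I_h := Ordinal (ltnW h_gt1).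
  rewrite -hyperplane_proper; apply: contra (Ux i0); apply: subv_trans; exact: subvf.
have := arrangement_weight x; rewrite x0 U0x mul1n mul0n muln0 addn0.
under eq_bigr => i _ do rewrite Ux mul1n.
rewrite -sum_expn_pred expn_ambient_pred -mulnDr => /eqP.
by rewrite eqn_pmul2l // => /eqP <-; rewrite addnK.
Qed.

Lemma arrangement_code_params :
  (\sum_(i < h) q ^ (k - u i.+1) <= q ^ (k - u 0))%N ->
  lin_code_params (code_of G) k (q ^ k.-1 - D).
Proof.
move=> few; apply: linear_code_params; last exact: arrangement_weight_eq.
  by rewrite subn_gt0 arrangement_defect_lt.
exact: arrangement_weight_ge.
Qed.

End ArrangementCode.

(** * Rounding errors in the Griesmer sum *)

Lemma sum_leq_indicator (k m : nat) : (\sum_(i < k) (m <= i) = k - m)%N.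
Proof. by elim: k => [|k IHk]; rewrite ?big_ord0 // big_ord_recr /= IHk; lia. Qed.

(** For [q > 1] and [m > 0] the left side adds the integer parts of [q ^ m.-1 / q ^ i]. *)
Lemma sum_rev_powers (q k m : nat) : (m <= k)%N ->
  (\sum_(i < k) (i < m) * q ^ (m.-1 - i) = \sum_(i < m) q ^ i)%N.
Proof.
move=> mk; rewrite [RHS](reindex_inj rev_ord_inj) /=.
rewrite (big_ord_widen k (fun i => q ^ (m - i.+1))%N mk) [RHS]big_mkcond.
by apply: eq_bigr => i _; case: (i < m)%N; rewrite ?mul1n // -subn1 -subnDA add1n.
Qed.

(* [r i] bounds the contribution to the [i]-th Griesmer term of the powers of [q]
   not divisible by [q ^ i]. *)
Lemma griesmer_exceeds_length (q k h n : nat) (u r : nat -> nat) :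
  (1 < q)%N -> (0 < h)%N -> (forall i : 'I_h, u i.+1 <= k)%N ->
  (n * (q - 1) + \sum_(i < h) q ^ u i.+1 = q ^ k + (h - 1) * q ^ u 0)%N ->
  (forall i, \sum_(j < h | u j.+1 <= i) q ^ (u j.+1).-1 <= r i * q ^ i)%N ->
  ((h - 1) * (\sum_(i < u 0) q ^ i) + \sum_(i < k) r i < k)%N ->
  (n < \sum_(i < k) ((q ^ k.-1 - \sum_(j < h) q ^ (u j.+1).-1) %/ q ^ i).+1)%N.
Proof.
move=> q_gt1 h_gt0 uk nE rP r_small; set d := (_ - _)%N.
have q_gt0 := ltnW q_gt1; have qX i : (0 < q ^ i)%N by rewrite expn_gt0 q_gt0.
(* The powers with [i < u j.+1] are divisible by [q ^ i] and pass through the division exactly;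
   [r i] absorbs the others. *)
have level (i : 'I_k) : (q ^ (k.-1 - i)
    <= d %/ q ^ i + (\sum_(j < h) (i < u j.+1) * q ^ ((u j.+1).-1 - i) + r i))%N.
  rewrite addnC -leq_subLR leq_divRL // mulnBl -expnD subnK; last by have := ltn_ord i; lia.
  apply: leq_sub2l; rewrite (bigID (fun j : 'I_h => u j.+1 <= i)%N) /= addnC mulnDl.
  apply: leq_add (rP i); rewrite big_distrl /= big_mkcond /=.
  apply: leq_sum => j _; rewrite -ltnNge; case: ltnP => // ij.
  by rewrite mul1n -expnD subnK //; lia.
have thetaE (m : nat) : ((q - 1) * (\sum_(i < m) q ^ i) + 1 = q ^ m)%N.
  exact: geometric_sum.
have levels : (\sum_(i < k) q ^ i <= \sum_(i < k) d %/ q ^ i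
    + (\sum_(j < h) \sum_(i < u j.+1) q ^ i + \sum_(i < k) r i))%N.
  have -> : (\sum_(j < h) \sum_(i < u j.+1) q ^ i
      = \sum_(i < k) \sum_(j < h) (i < u j.+1) * q ^ ((u j.+1).-1 - i))%N.
    by rewrite exchange_big; apply: eq_bigr => j _; rewrite sum_rev_powers.
  rewrite -!big_split /= (reindex_inj rev_ord_inj) /=; apply: leq_sum => i _.
  by apply: leq_trans (level i); rewrite leq_pexp2l //; have := ltn_ord i; lia.
(* The length in terms of geometric sums. Combined with [levels], the Griesmer sum is at least
   [n + k] minus the two terms that [r_small] keeps below [k]. *)
have n_theta : (n + \sum_(j < h) \sum_(i < u j.+1) q ^ i
    = \sum_(i < k) q ^ i + (h - 1) * (\sum_(i < u 0) q ^ i))%N.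
  have q1 : (0 < q - 1)%N by rewrite subn_gt0.
  apply/eqP; rewrite -(eqn_pmul2l q1) -(eqn_add2r h) !mulnDr -addnA.
  have -> : ((q - 1) * (\sum_(j < h) \sum_(i < u j.+1) q ^ i) + h
      = \sum_(j < h) q ^ u j.+1)%N.
    under [RHS]eq_bigr => j _ do rewrite -thetaE.
    by rewrite big_split /= sum1_card card_ord big_distrr.
  move: nE; rewrite -!thetaE; move: (\sum_(i < k) _)%N (\sum_(i < u 0%N) _)%N => X Y.
  move: (q - 1)%N (\sum_(_ < h) _)%N => c Z.
  by case: (h) h_gt0 => // h' _; rewrite subn1 /=; nia.
have -> : (\sum_(i < k) (d %/ q ^ i).+1 = \sum_(i < k) d %/ q ^ i + k)%N.
  under eq_bigr => i _ do rewrite -addn1.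
  by rewrite big_split /= sum1_card card_ord.
lia.
Qed.

(** The integer part of [d / q ^ i] plus one is the ceiling of [(d + 1) / q ^ i], so this is the
    Griesmer sum for distance [d + 1]. *)
Lemma distance_optimal_griesmer (F : finFieldType) (n k d : nat) :
  (n < \sum_(i < k) (d %/ #|F| ^ i).+1)%N -> distance_optimal F n k d.
Proof.
move=> n_lt [C [dimC _ C_min]]; move: n_lt; rewrite ltnNge => /negP; apply.
have := @griesmer_bound F n d C setT; rewrite cardsT card_ord dimC; apply=> c cC c0.
have := C_min c 0 cC (mem0v C) c0; rewrite /hdist subr0.
by move/leq_trans; apply; apply: subset_leq_card; apply/subsetP => j; rewrite !inE.
Qed.

(** * The numerical conditions in the two cases *)

Lemma homo_leq_up_to (u : nat -> nat) (h : nat) :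
  (forall i, (1 <= i < h)%N -> (u i <= u i.+1)%N) ->
  forall i j, (1 <= i <= j)%N -> (j <= h)%N -> (u i <= u j)%N.
Proof.
move=> u_step i j /andP[i1 ij] jh; elim: j ij jh => [|j IHj]; first by lia.
rewrite leq_eqVlt => /predU1P[-> // | ij] jh.
by apply: leq_trans (IHj _ _) (u_step j _); lia.
Qed.

Lemma case1_numerics (q k t : nat) (s u : nat -> nat) :
  let S := fun b => (\sum_(1 <= i < b.+1) s i)%N in
  (1 < q)%N -> (1 < S t)%N -> (0 < u 0%N < u 1%N)%N ->
  (forall i j, (1 <= i <= j)%N -> (j <= S t)%N -> (u i <= u j)%N) ->
  (forall i, (i <= S t)%N -> (u i <= k)%N) ->
  (forall i, (1 <= i <= t)%N -> (1 <= s i < q)%N) ->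
  (forall b, (1 <= b <= t)%N -> forall j, (S b.-1 < j <= S b)%N ->
     u j = u (S b.-1).+1) ->
  (forall b, (1 <= b < t)%N -> (u (S b) < u (S b).+1)%N) ->
  ((S t - 1) * (\sum_(i < u 0%N) q ^ i) < u 1%N)%N ->
  (\sum_(i < S t) q ^ (k - u i.+1) <= q ^ (k - u 0%N))%N /\
  exists r, (forall i, \sum_(j < S t | u j.+1 <= i) q ^ (u j.+1).-1 <= r i * q ^ i)%N /\
    ((S t - 1) * (\sum_(i < u 0%N) q ^ i) + \sum_(i < k) r i < k)%N.
Proof.
move=> S q_gt1 St_gt1 /andP[u0_gt0 u01] u_mono uk s_bound u_const u_jump u1_gt.
have q_gt0 := ltnW q_gt1; have u1_gt0 := ltn_trans u0_gt0 u01.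
have u1k : (u 1%N <= k)%N by apply: uk; lia.
split.
  have t1 : (1 <= t <= t)%N.
    by rewrite leqnn andbT lt0n; apply: contraTneq St_gt1 => ->; rewrite /S big_geq.
  have uk' j : (1 <= j <= S t)%N -> (u j <= k)%N by case/andP=> _; apply: uk.
  have := @dual_blocks_sum q t s u s_bound u_const u_jump k t t1 uk'.
  rewrite -/(S t) big_add1 big_mkord => dual.
  apply: leq_trans (leq_trans (leq_addr _ _) dual) _.
  by rewrite leq_pexp2l //; lia.
(* No power is rounded below level [u 1]. From there on the rounded powers add up to at most
   [q ^ i], so the total error is [k - u 1]. *)
exists (fun i => (u 1%N <= i)%N : nat); split=> [i|]; last first.
  by rewrite sum_leq_indicator; lia.
have [u1i | iu1] /= := leqP (u 1%N) i; last first.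
  rewrite big1 // => j ui; have := u_mono 1%N j.+1 isT (ltn_ord j); lia.
have := @low_blocks_sum q t s u s_bound u_const u_jump u_mono u1_gt0 t i q_gt0 (leqnn t).
rewrite -/(S t) big_add1 big_mkord expnS mul1n => low.
rewrite -(leq_pmul2l q_gt0); apply: leq_trans (ltnW low); rewrite big_distrr /=.
apply: leq_sum => j _; have : (0 < u j.+1)%N by apply: leq_trans (u_mono 1%N j.+1 _ _).
by case: (u j.+1) => // m _; rewrite expnS.
Qed.

Lemma case2_numerics (q k h uu : nat) (u : nat -> nat) :
  (1 < q)%N -> (1 < h)%N -> (0 < u 0%N < uu)%N -> (uu <= k)%N ->
  (forall i : 'I_h, u i.+1 = uu) ->
  (\sum_(i < h) q ^ (u i.+1).-1 < q ^ k.-1)%N ->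
  ((h - 1) * (\sum_(i < u 0%N) q ^ i) + \sum_(1 <= i < (k - uu).+1) h %/ q ^ i
    < ih q h + uu)%N ->
  (\sum_(i < h) q ^ (k - u i.+1) <= q ^ (k - u 0%N))%N /\
  exists r, (forall i, \sum_(j < h | u j.+1 <= i) q ^ (u j.+1).-1 <= r i * q ^ i)%N /\
    ((h - 1) * (\sum_(i < u 0%N) q ^ i) + \sum_(i < k) r i < k)%N.
Proof.
move=> q_gt1 h_gt1 /andP[u0_gt0 u0u] uuk uE defect small.
have q_gt0 := ltnW q_gt1.
have h_lt : (h < q ^ (k - uu))%N.
  have qX : (0 < q ^ uu.-1)%N by rewrite expn_gt0 q_gt0.
  rewrite -(ltn_pmul2r qX) -expnD; have -> : (k - uu + uu.-1 = k.-1)%N by lia.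
  apply: leq_trans defect; rewrite ltnS.
  by under eq_bigr => i _ do rewrite uE; rewrite sum_nat_const card_ord.
(* Ensures that the subtraction [k - uu - ih q h] below is not truncated. *)
have ih_le : (ih q h < k - uu)%N.
  rewrite -(ltn_exp2l _ _ q_gt1); apply: leq_ltn_trans h_lt.
  by apply: dvdn_leq (expn_ih_dvdn _ _); lia.
split.
  under eq_bigr => i _ do rewrite uE.
  rewrite sum_nat_const card_ord.
  have h_le : (h <= q ^ (uu - u 0%N))%N.
    apply: (case2_few_subspaces q_gt1 h_gt1 u0_gt0 _ h_lt); first by rewrite subn_gt0.
    by rewrite subnKC // ltnW.
  have -> : (k - u 0%N = (uu - u 0%N) + (k - uu))%N by lia.
  by rewrite expnD leq_mul2r h_le orbT.
(* From level [uu] on this is the ceiling of [h / q ^ (i - uu).+1]: the division is exact as long as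
   the exponent is at most [ih q h]. *)
pose r i := if (i < uu)%N then 0%N else (h %/ q ^ (i - uu).+1 + (ih q h <= i - uu))%N.
exists r; split=> [i|].
  rewrite /r; case: ltnP => [iu | ui].
    by rewrite big1 // => j; rewrite uE leqNgt iu.
  under eq_big => [j|j _] do [rewrite uE ui | rewrite uE].
  rewrite sum_nat_const card_ord.
  have {3}-> : i = ((i - uu).+1 + uu.-1)%N by lia.
  rewrite expnD mulnA leq_mul2r; apply/orP; right; case: (leqP (ih q h)) => ihi.
    by rewrite addn1 ltnW // ltn_ceil // expn_gt0 q_gt0.
  by rewrite addn0 divnK // dvdn_le_ih.
(* With this total, the required bound is the hypothesis [small] rearranged. *)
have -> : (\sum_(i < k) r i
    = \sum_(1 <= i < (k - uu).+1) h %/ q ^ i + (k - uu - ih q h))%N.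
  rewrite -(big_mkord xpredT r) (@big_cat_nat _ _ _ uu) //= big_nat big1 => [|i]; last first.
    by rewrite /r => /andP[_ ->].
  rewrite add0n -{1}[uu]add0n big_addn big_add1 /= -(sum_leq_indicator (k - uu) (ih q h)).
  rewrite -(big_mkord xpredT (fun i => ih q h <= i : nat)%N) -big_split /=.
  by apply: eq_bigr => i _; rewrite /r ltnNge leq_addl addnK.
by move: small; lia.
Qed.

(** * Length, parameters and optimality of the code *)

Theorem theorem3p3 (F : finFieldType) (k h : nat) (u : nat -> nat)
  (U : nat -> {vspace 'rV[F]_k}) (n : nat) (G : 'M[F]_(k, n)) :
  let q := #|F| in
  (3 <= k)%N -> (2 <= h)%N ->
  (1 <= u 0%N < u 1%N)%N ->
  (forall i, (1 <= i < h)%N -> (u i <= u i.+1)%N) ->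
  (forall i, (i <= h)%N -> \dim (U i) = u i) ->
  (forall i j, (1 <= i <= h)%N -> (1 <= j <= h)%N -> i != j ->
      (U i :&: U j)%VS = U 0%N) ->
  (q ^ k - q ^ k.-1 > q ^ u 0%N - 1 + \sum_(1 <= i < h.+1) (q ^ u i - q ^ u 0%N))%N ->
  (* columns of G: exactly one representative of each projective point of
     the set of nonzero vectors outside U_1 \cup ... \cup U_h *)
  (forall j : 'I_n, (col j G)^T != 0 /\
      forall i, (1 <= i <= h)%N -> (col j G)^T \notin U i) ->
  (forall j j' : 'I_n, j != j' -> forall lam : F, (col j G)^T != lam *: (col j' G)^T) ->
  (forall v : 'rV[F]_k, v != 0 -> (forall i, (1 <= i <= h)%N -> v \notin U i) ->
      exists j : 'I_n, exists lam : F, v = lam *: (col j G)^T) ->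
  (* case 1) or case 2) *)
  ((exists t : nat, exists s : nat -> nat,
      let S := fun b => (\sum_(1 <= i < b.+1) s i)%N in
      [/\ forall i, (1 <= i <= t)%N -> (1 <= s i < q)%N,
          h = S t,
          forall b, (1 <= b <= t)%N -> forall j, (S b.-1 < j <= S b)%N ->
             u j = u (S b.-1).+1,
          forall b, (1 <= b < t)%N -> (u (S b) < u (S b).+1)%N
        & (u 1%N > (h - 1) * ((q ^ u 0%N - 1) %/ (q - 1)))%N])
   \/
   (exists uu : nat,
      (forall i, (1 <= i <= h)%N -> u i = uu) /\
      (ih q h + uu > (h - 1) * ((q ^ u 0%N - 1) %/ (q - 1))
                     + \sum_(1 <= i < (k - uu).+1) h %/ q ^ i)%N)) ->
  let d := (q ^ k.-1 - \sum_(1 <= i < h.+1) q ^ (u i).-1)%N in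
  [/\ (n * (q - 1) = (q ^ k - q ^ u 0%N) - \sum_(1 <= i < h.+1) (q ^ u i - q ^ u 0%N))%N,
      lin_code_params (code_of G) k d
    & distance_optimal F n k d].
Proof.
move=> q k3 h2 u01 u_step dimU UI small G_out G_indep G_all cases d.
have [u0_gt0 u0_lt] := andP u01.
have q_gt1 : (1 < q)%N by apply: finRing_gt1.
have u_mono := homo_leq_up_to u_step.
have uk i : (i <= h)%N -> (u i <= k)%N by move=> ih; rewrite -dimU // dim_arrangement.
have dimS (i : 'I_h) : \dim (U i.+1) = u i.+1 by apply: dimU.
have dim0 : \dim (U 0%N) = u 0%N by apply: dimU.
have thetaE : ((q ^ u 0%N - 1) %/ (q - 1) = \sum_(i < u 0%N) q ^ i)%N.
  by rewrite -geometric_sum ?(ltnW q_gt1) // addnK mulKn // subn_gt0.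
have u0_lt_dim (i : 'I_h) : (\dim (U 0%N) < \dim (U i.+1))%N.
  by rewrite dim0 dimS; apply: leq_trans u0_lt (u_mono 1%N i.+1 _ _).
have UI' (i j : 'I_h) : i != j -> (U i.+1 :&: U j.+1)%VS = U 0%N by move=> ij; apply: UI; rewrite ?ltn_ord // eqSS.
have G_out' j (i : 'I_h) : (col j G)^T \notin U i.+1 by exact: ((G_out j).2 i.+1 (ltn_ord i)).
(* The condition [v != 0] is absorbed, because the zero vector lies in every [U i]. *)
have G_all' (v : 'rV[F]_k) : (forall i : 'I_h, v \notin U i.+1) ->
    exists j : 'I_n, exists a : F, v = a *: (col j G)^T.
  move=> v_out; apply: G_all => [|[//|i] /andP[_ ih]]; last exact: (v_out (Ordinal ih)).
  by apply: contraNneq (v_out (Ordinal (ltnW h2))) => ->; rewrite mem0v.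
have U0_gt0 : (0 < \dim (U 0%N))%N by rewrite dim0.
have sumS (f : nat -> nat) : (\sum_(1 <= i < h.+1) f (u i) = \sum_(i < h) f (\dim (U i.+1)))%N.
  by rewrite big_add1 big_mkord; apply: eq_bigr => i _; rewrite dimS.
have small' : (#|F| ^ k - #|F| ^ k.-1 > #|F| ^ \dim (U 0%N) - 1
    + \sum_(i < h) (#|F| ^ \dim (U i.+1) - #|F| ^ \dim (U 0%N)))%N.
  by rewrite -(sumS (fun x => #|F| ^ x - #|F| ^ _)%N) dim0.
have lenE := arrangement_length h2 UI' G_out' G_indep G_all'.
have defect := arrangement_defect_lt U0_gt0 u0_lt_dim small'.
have dE : d = (q ^ k.-1 - \sum_(i < h) q ^ (\dim (U i.+1)).-1)%N.
  by rewrite /d (sumS (fun x => q ^ x.-1)%N).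
(* All that is drawn from the case distinction: [few] yields a word of weight [d], and [r] controls
   the Griesmer sum. *)
have [few [r [rP r_small]]] :
  (\sum_(i < h) q ^ (k - u i.+1) <= q ^ (k - u 0%N))%N /\
  exists r, (forall i, \sum_(j < h | u j.+1 <= i) q ^ (u j.+1).-1 <= r i * q ^ i)%N /\
    ((h - 1) * (\sum_(i < u 0%N) q ^ i) + \sum_(i < k) r i < k)%N.
  case: cases => [[t [s [s_bound hS u_const u_jump]]] | [uu [uE]]]; rewrite thetaE.
    move: h2 uk u_mono; rewrite hS => h2 uk u_mono u1_gt.
    exact: (case1_numerics q_gt1 h2 u01 u_mono uk s_bound u_const u_jump).
  have uE' (i : 'I_h) : u i.+1 = uu by apply: uE; apply: ltn_ord.
  have u1 : u 1%N = uu by apply: uE; apply: ltnW.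
  move=> small2.
  apply: (case2_numerics (uu := uu)) => //; first by rewrite -u1.
    by rewrite -u1 uk // ltnW.
  by move: defect; under eq_bigr => i _ do rewrite dimS.
have few' : (\sum_(i < h) q ^ (k - \dim (U i.+1)) <= q ^ (k - \dim (U 0%N)))%N.
  by rewrite dim0; under eq_bigr => i _ do rewrite dimS.
split.
- move: lenE; rewrite (sumS (fun x => q ^ x - q ^ _)%N) dim0 -/q.
  have : (\sum_(i < h) (q ^ \dim (U i.+1) - q ^ u 0%N) + h * q ^ u 0%N
      = \sum_(i < h) q ^ \dim (U i.+1))%N.
    rewrite -[X in (X * _)%N]card_ord -sum_nat_const -big_split; apply: eq_bigr => i _ /=.
    by rewrite subnK // -dim0 leq_pexp2l ?(ltnW (u0_lt_dim i)) // ltnW.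
  have -> : (h * q ^ u 0%N = q ^ u 0%N + (h - 1) * q ^ u 0%N)%N by rewrite -mulSn subn1 (ltn_predK h2).
  move=> <-; rewrite !addnA => /addIn <-.
  by rewrite addnK addnK.
- by rewrite dE; apply: arrangement_code_params.
apply: distance_optimal_griesmer; rewrite /d big_add1 big_mkord.
apply: (griesmer_exceeds_length q_gt1 (ltnW h2) _ _ rP r_small) => [i|].
  by apply: uk; apply: ltn_ord.
rewrite -dim0 -lenE; congr (_ + _)%N.
by apply: eq_bigr => i _; rewrite dimS.
Qed.
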